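(* Let $q_0,q_1,\dots,q_{m-1}\in\mathbb{H}$ be the coefficients of a simple monic polynomial $p_l(z)=z^m+q_{m-1}z^{m-1}+\dots+q_1z+q_0$, and assume that $|q_0|\ge1$. Then $\alpha\le\mathcal{T}$, where $$\alpha:=\max_{1\le i\le m-1}\{|q_0|,\,1+|q_i|\}\quad\text{and}\quad \mathcal{T}:=\max\left\{1,\sum_{i=0}^{m-1}|q_i|\right\}.$$
   Context: $\mathbb{H}$ is the skew field of real quaternions with its usual modulus $|\cdot|$. The quantity $\alpha$ is the maximum of $|q_0|$ and all the numbers $1+|q_i|$ for $1\le i\le m-1$. *)

(* Defs.v *)
From HB Require Import structures.
From mathcomp Require Import all_boot all_order all_algebra.
From mathcomp Require Import reals.
From mathcomp Require Import ring.

Set Implicit Arguments.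
Unset Strict Implicit.
Unset Printing Implicit Defensive.

Import Order.TTheory GRing.Theory Num.Theory.

Local Open Scope ring_scope.

(* Quat a b c d is the quaternion a + b i + c j + d k. *)
Record quat (R : realType) := Quat { qre : R; qi : R; qj : R; qk : R }.

Section Quaternions.
Variable R : realType.
Local Notation H := (quat R).
Implicit Types x y z : H.

Definition quat_to_prod x := (qre x, qi x, qj x, qk x).
Definition quat_of_prod (t : R * R * R * R) : H :=
  let: (a, b, c, d) := t in Quat a b c d.

Lemma quat_to_prodK : cancel quat_to_prod quat_of_prod.
Proof. by case. Qed.

HB.instance Definition _ := Choice.copy H (can_type quat_to_prodK).

Definition addq x y :=
  Quat (qre x + qre y) (qi x + qi y) (qj x + qj y) (qk x + qk y).
Definition oppq x := Quat (- qre x) (- qi x) (- qj x) (- qk x).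
Definition zeroq : H := Quat 0 0 0 0.
Definition oneq : H := Quat 1 0 0 0.
Definition mulq x y :=
  let: Quat a b c d := x in
  let: Quat e f g h := y in
  Quat (a * e - b * f - c * g - d * h)
       (a * f + b * e + c * h - d * g)
       (a * g - b * h + c * e + d * f)
       (a * h + b * g - c * f + d * e).

Lemma addqA : associative addq.
Proof. by case=> ????[????][????]; congr Quat; rewrite /= addrA. Qed.
Lemma addqC : commutative addq.
Proof. by case=> ????[????]; congr Quat; rewrite /= addrC. Qed.
Lemma add0q : left_id zeroq addq.
Proof. by case=> ????; rewrite /addq /= !add0r. Qed.
Lemma addNq : left_inverse zeroq oppq addq.
Proof. by case=> ????; rewrite /addq /= !addNr. Qed.
Lemma mulqA : associative mulq.
Proof. by case=> ????[????][????]; rewrite /mulq; congr Quat; ring. Qed.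
Lemma mul1q : left_id oneq mulq.
Proof. by case=> ????; rewrite /mulq /oneq; congr Quat; ring. Qed.
Lemma mulq1 : right_id oneq mulq.
Proof. by case=> ????; rewrite /mulq /oneq; congr Quat; ring. Qed.
Lemma mulqDl : left_distributive mulq addq.
Proof. by case=> ????[????][????]; rewrite /mulq /addq /=; congr Quat; ring. Qed.
Lemma mulqDr : right_distributive mulq addq.
Proof. by case=> ????[????][????]; rewrite /mulq /addq /=; congr Quat; ring. Qed.
Lemma oneq_neq0 : oneq != zeroq.
Proof. by apply/eqP => -[/eqP]; rewrite oner_eq0. Qed.

HB.instance Definition _ := GRing.isNzRing.Build H
  addqA addqC add0q addNq mulqA mul1q mulq1 mulqDl mulqDr oneq_neq0.

Definition sqnormq x := qre x ^+ 2 + qi x ^+ 2 + qj x ^+ 2 + qk x ^+ 2.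
Definition modq x : R := Num.sqrt (sqnormq x).

Definition invq x : H :=
  let n := sqnormq x in Quat (qre x / n) (- qi x / n) (- qj x / n) (- qk x / n).

Lemma sqnormq_eq0 x : (sqnormq x == 0) = (x == 0).
Proof.
case: x => a b c d; apply/idP/eqP => [|->]; last first.
  by rewrite /sqnormq /= !expr0n /= !addr0.
rewrite /sqnormq /= !paddr_eq0 ?addr_ge0 ?sqr_ge0 // !sqrf_eq0.
by case/andP=> /andP[/andP[/eqP-> /eqP->] /eqP->] /eqP->.
Qed.

Lemma mulVq x : x != 0 -> invq x * x = 1.
Proof.
rewrite -sqnormq_eq0; case: x => a b c d; rewrite /sqnormq /= => n0.
change (mulq (invq (Quat a b c d)) (Quat a b c d) = oneq).
by rewrite /invq /sqnormq /mulq /oneq /=; congr Quat; field.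
Qed.

Lemma mulqV x : x != 0 -> x * invq x = 1.
Proof.
rewrite -sqnormq_eq0; case: x => a b c d; rewrite /sqnormq /= => n0.
change (mulq (Quat a b c d) (invq (Quat a b c d)) = oneq).
by rewrite /invq /sqnormq /mulq /oneq /=; congr Quat; field.
Qed.

Lemma invq0 : invq 0 = 0.
Proof. by congr Quat; rewrite /= ?oppr0 mul0r. Qed.

Fact unitqVl : {in [pred x : H | x != 0], left_inverse 1 invq *%R}.
Proof. by move=> x; apply: mulVq. Qed.
Fact unitqVr : {in [pred x : H | x != 0], right_inverse 1 invq *%R}.
Proof. by move=> x; apply: mulqV. Qed.
Fact unitqP x y : y * x = 1 /\ x * y = 1 -> x \in [pred x : H | x != 0].
Proof.
case=> yx _; rewrite inE; apply/eqP => x0.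
by move/eqP: yx; rewrite x0 mulr0 eq_sym oner_eq0.
Qed.
Fact invq_out : {in [predC [pred x : H | x != 0]], invq =1 id}.
Proof. by move=> x; rewrite !inE negbK => /eqP->; apply: invq0. Qed.

HB.instance Definition _ := GRing.NzRing_hasMulInverse.Build H
  unitqVl unitqVr unitqP invq_out.

Lemma unitqE x : (x \is a GRing.unit) = (x != 0).
Proof. by []. Qed.

(* For p : {poly H}, the coefficients p`_i stand to the left of the powers of
   the variable, and the Horner value p.[z] is \sum_i p`_i * z ^+ i: this is a
   "simple" (one-sided) left polynomial p_l.  Here m is the degree of p. *)
Implicit Type p : {poly H}.

(* The range 1 <= i < m is empty when m = 1; alpha is then |q_0|. *)
Definition alpha (m : nat) p : R :=
  \big[Num.max/modq p`_0]_(1 <= i < m) (1 + modq p`_i).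

Definition calT (m : nat) p : R :=
  Num.max 1 (\sum_(0 <= i < m) modq p`_i).

End Quaternions.

(* Main.v *)
Require Import Defs.
From HB Require Import structures.
From mathcomp Require Import all_boot all_order all_algebra.
From mathcomp Require Import reals.

Import Order.TTheory GRing.Theory Num.Theory.
Local Open Scope ring_scope.

(** Isolating the constant coefficient writes the sum of the moduli as
    [|q_0| + \sum_(1 <= i < m) |q_i|], a sum of nonnegative terms.  It therefore
    dominates [|q_0|] and each [|q_0| + |q_i|]; the hypothesis [1 <= |q_0|] turns
    the latter into a bound on [1 + |q_i|].  So every candidate in the maximum
    defining [alpha] is already at most the sum of the moduli. *)

Lemma modq_ge0 (R : realType) (x : quat R) : 0 <= modq x.
Proof. exact: sqrtr_ge0. Qed.

Theorem lemma4p5 (R : realType) (m : nat) (hm : (0 < m)%N)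
    (p : {poly quat R}) (hmonic : p \is monic) (hdeg : size p = m.+1)
    (h0 : 1 <= modq p`_0) :
  alpha m p <= calT m p.
Proof.
rewrite /alpha /calT le_max; apply/orP; right.
have tail_ge0 : 0 <= \sum_(1 <= i < m) modq p`_i.
  by apply: sumr_ge0 => i _; apply: modq_ge0.
rewrite (big_ltn hm) [leLHS]big_nat.
apply: bigmax_le => [|i hi]; first by rewrite lerDl.
apply: lerD => //.
rewrite (bigD1_seq i) ?iota_uniq ?mem_index_iota //= lerDl.
by apply: sumr_ge0 => j _; apply: modq_ge0.
Qed.
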